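(* Let $X$ be a finite-dimensional real Banach space with $\dim X\ge 2$. Then $X$ is not uniformly non-square if and only if $\Omega(X)=\frac{8}{5}$.
   Context: $S_X$ denotes the unit sphere of $X$. For $x,y\in X$, $x$ is isosceles orthogonal to $y$, written $x\perp_I y$, if $\|x+y\|=\|x-y\|$. The constant $\Omega(X)$ is defined by $$\Omega(X)=\sup\left\{\frac{\|x+2y\|^2+\|2x+y\|^2}{5\|x+y\|^2}: x,y\in S_X,\ x\perp_I y\right\}.$$ A Banach space $X$ is uniformly non-square if there exists $\delta\in(0,1)$ such that for any $x_1,x_2\in S_X$ either $\frac{\|x_1+x_2\|}{2}\le 1-\delta$ or $\frac{\|x_1-x_2\|}{2}\le 1-\delta$. *)

(* Defs.v *)
From mathcomp Require Import all_boot all_order all_algebra.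
From mathcomp Require Import all_classical all_reals all_analysis.

Set Implicit Arguments.
Unset Strict Implicit.
Unset Printing Implicit Defensive.

Import Order.TTheory GRing.Theory Num.Theory.
Import numFieldNormedType.Exports.

Local Open Scope classical_set_scope.
Local Open Scope ring_scope.

Definition unit_sphere (R : realType) (X : normedModType R) : set X :=
  [set x | `|x| = 1].

Definition isosceles_orthogonal (R : realType) (X : normedModType R)
    (x y : X) : Prop :=
  `|x + y| = `|x - y|.

(* The denominator never vanishes on the index set: if x is isosceles
   orthogonal to y and x + y = 0, then x - y = 0 as well, hence x = 0. *)
Definition Omega_set (R : realType) (X : normedModType R) : set R :=
  [set r | exists x y : X,
     [/\ unit_sphere x, unit_sphere y, isosceles_orthogonal x y &
         r = (`|x + 2 *: y| ^+ 2 + `|2 *: x + y| ^+ 2)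
             / (5 * `|x + y| ^+ 2)]].

(* [sup] is real-valued, with the junk value 0 on empty or unbounded sets.
   [Omega_set X] is always bounded above, since `|x + 2 *: y| and
   `|2 *: x + y| are at most 2 * `|x + y| when x is isosceles orthogonal
   to y; it is nonempty as soon as dim X >= 2. *)
Definition Omega (R : realType) (X : normedModType R) : R :=
  sup (Omega_set X).

Definition uniformly_non_square (R : realType) (X : normedModType R) : Prop :=
  exists delta : R, [/\ 0 < delta, delta < 1 &
    forall x1 x2 : X, unit_sphere x1 -> unit_sphere x2 ->
      `|x1 + x2| / 2 <= 1 - delta \/ `|x1 - x2| / 2 <= 1 - delta].

(* Main.v *)
Require Import Defs.
From HB Require Import structures.
From mathcomp Require Import all_boot all_order all_algebra.
From mathcomp Require Import all_classical all_reals all_analysis.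
From mathcomp Require Import ring lra.

Import Order.TTheory GRing.Theory Num.Theory.
Import numFieldNormedType.Exports.

Local Open Scope ring_scope.

(** Write x = (u + v) / 2 and y = (u - v) / 2. Isosceles orthogonality of x and
y says |u| = |v|, while x + 2 y = (3 u - v) / 2 and 2 x + y = (3 u + v) / 2 have
norm at most 2 |u|, so the quotient defining Omega is at most 8 / 5. Uniform
non-squareness, applied to u / |u| and v / |v|, keeps one of these two norms
uniformly below 2 |u|. Conversely, if X is not uniformly non-square, compactness
of the unit sphere gives unit vectors u and v with |u + v| = |u - v| = 2; then x
and y are unit vectors and both norms equal 2. *)

Section FiniteDimensional.
Context {R : realType} {X : normedModType R}.

(** Expanding [a] in the standard basis turns [g] into a finite sum of coordinates times fixed
    vectors. *)
Lemma linear_rV_continuous (n : nat) (g : {linear 'rV[R]_n -> X}) :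
  continuous g.
Proof.
have -> : (g : _ -> X) = fun a => \sum_i a ord0 i *: g (delta_mx ord0 i).
  apply/funext => a; rewrite {1}(row_sum_delta a) linear_sum.
  by apply: eq_bigr => i _; rewrite linearZ.
apply: continuous_big => [|i _ a]; first exact: add_continuous.
apply: (@continuous_comp _ _ _ (fun b : 'rV[R]_n => b ord0 i) ( *:%R^~ _)).
  exact: coord_continuous.
exact: scalel_continuous.
Qed.

(** Take for [m] the minimum of [|g a|] on the compact unit sphere of ['rV[R]_n]. Injectivity makes
    it positive, and homogeneity carries the bound to every [a]. *)
Lemma linear_rV_norm_ge (n : nat) (g : {linear 'rV[R]_n -> X}) :
  injective g -> exists2 m, 0 < m & forall a, m * `|a| <= `|g a|.
Proof.
move=> g_inj; pose S := [set a : 'rV[R]_n | `|a| = 1]%classic.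
have normalized a : a != 0 -> S (`|a|^-1 *: a).
  by move=> a0; rewrite /S/= normrZ normfV normr_id mulVf// normr_eq0//.
have [[a Sa]|S0] := pselect (S !=set0)%classic; last first.
  (* With an empty sphere the only vector is 0, so any positive [m] will do. *)
  exists 1 => // a; have [->|/normalized Sa] := eqVneq a 0.
    by rewrite normr0 mulr0.
  by case: S0; exists (`|a|^-1 *: a).
have cS : compact S.
  apply: bounded_closed_compact.
    by exists 1; split => // M M1 b /= ->; exact: ltW.
  apply: (@preimage_closed _ _ (fun b : 'rV[R]_n => `|b|) [set 1]%classic).
    by move=> b _; exact: norm_continuous.
  exact: closed_eq.
have [] := @compact_EVT_min _ R (fun b => `|g b|) S.
- by exists a.
- exact: cS.
- apply: continuous_subspaceT => b; apply: continuous_comp.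
    exact: linear_rV_continuous.
  exact: norm_continuous.
move=> c; rewrite inE /S/= => c1 cmin; exists `|g c|.
  rewrite normr_gt0; apply/eqP => gc0.
  have c0 : c = 0 by apply: g_inj; rewrite gc0 linear0.
  by move: c1; rewrite c0 normr0 => /eqP; rewrite eq_sym oner_eq0.
move=> b; have [->|b0] := eqVneq b 0; first by rewrite normr0 mulr0.
have := cmin _ (mem_set (normalized _ b0)).
by rewrite linearZ/= normrZ normfV normr_id ler_pdivlMl ?normr_gt0// mulrC.
Qed.

(** The sphere is the continuous image of its preimage in ['rV[R]_n], which is closed by continuity
    of the norm and bounded by [m^-1]. *)
Lemma unit_sphere_compact (n : nat) :
  Vector.axiom n X -> compact (@unit_sphere R X).
Proof.
move=> [f f_lin [g fK gK]].
have g_lin : linear g.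
  by move=> k a b; apply: (can_inj fK); rewrite f_lin !gK.
pose gL : {linear 'rV[R]_n -> X} :=
  HB.pack g (GRing.isLinear.Build _ _ _ _ g g_lin).
have [m m0 mP] := @linear_rV_norm_ge n gL (can_inj gK).
have g_cont := @linear_rV_continuous n gL.
have -> : @unit_sphere R X = (gL @` (gL @^-1` @unit_sphere R X))%classic.
  apply/seteqP; split => [x Sx|_ [a Sa <-]//].
  by exists (f x); rewrite /= /gL/= fK.
apply: continuous_compact; first exact: continuous_subspaceT.
apply: bounded_closed_compact.
  exists m^-1; split=> [|M mM a]; first by rewrite num_real.
  rewrite /= /unit_sphere/= => ga1; apply: le_trans (ltW mM).
  by have := mP a; rewrite /= ga1 mulrC -ler_pdivlMr// div1r.
apply: (@preimage_closed _ _ (fun a => `|gL a|) [set 1]%classic).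
  move=> a _; apply: continuous_comp; [exact: g_cont|exact: norm_continuous].
exact: closed_eq.
Qed.

End FiniteDimensional.

Section Omega.
Context {R : realType} {X : normedModType R}.
Implicit Types u v x y : X.

Lemma not_uniformly_non_square_attained :
  compact (@unit_sphere R X) -> ~ uniformly_non_square X ->
  exists u v, [/\ `|u| = 1, `|v| = 1, `|u + v| = 2 & `|u - v| = 2].
Proof.
move=> cS nsq.
(* A pair with [F = 2] is what is sought. A maximum of [F] below 2 over pairs of unit vectors would
   make [X] uniformly non-square. *)
pose F (p : X * X) := Num.min `|p.1 + p.2| `|p.1 - p.2|.
have F_cont : continuous F.
  move=> p.
  apply: (@continuous_min R _ (fun p : X * X => `|p.1 + p.2|)
    (fun p => `|p.1 - p.2|)).
    apply: (continuous_comp (f := fun p : X * X => p.1 + p.2)).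
      exact: add_continuous.
    exact: norm_continuous.
  apply: (continuous_comp (f := fun p : X * X => p.1 - p.2)).
    exact: sub_continuous.
  exact: norm_continuous.
have [[x Sx]|S0] := pselect (@unit_sphere R X !=set0)%classic; last first.
  case: nsq; exists (1 / 2); split; [lra|lra|move=> x1 x2 Sx1 _].
  by case: S0; exists x1.
have [] := @compact_EVT_max _ R F
  (@unit_sphere R X `*` @unit_sphere R X)%classic.
- by exists (x, x).
- exact: compact_setX.
- exact: continuous_subspaceT.
move=> [u v]; rewrite inE /unit_sphere/= => -[u1 v1] Fmax.
have uvD := ler_normD u v; have uvB := ler_normB u v.
have [F2|F2] := ltP (F (u, v)) 2; last first.
  exists u, v; move: F2; rewrite /F/= le_min => /andP[? ?].
  by split=> //; apply/eqP; rewrite eq_le; apply/andP; split => //; lra.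
have F0 : 0 <= F (u, v) by rewrite /F/= le_min !normr_ge0.
(* Here [1 - delta = (2 + F (u, v)) / 4] is at least [F (u, v) / 2]. Dividing by 4 rather than 2
   keeps [delta < 1] even when [F (u, v) = 0]. *)
case: nsq; exists ((2 - F (u, v)) / 4); split; [lra|lra|move=> x1 x2 Sx1 Sx2].
have /Fmax : (x1, x2) \in (@unit_sphere R X `*` @unit_sphere R X)%classic
  by rewrite inE.
by rewrite {1}/F/= ge_min => /orP[] ?; [left|right]; lra.
Qed.

Lemma ler_norm_3B u v s : `|u| = s -> `|3 *: u - v| <= 2 * s + `|u - v|.
Proof.
move=> us; have -> : 3 *: u - v = 2 *: u + (u - v).
  by rewrite addrA -[X in _ + X - _]scale1r -scalerDl; congr (_ *: _ - _); ring.
by rewrite (le_trans (ler_normD _ _))// normrZ ger0_norm// us.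
Qed.

Lemma norm_3B u v : `|u| = 1 -> `|v| = 1 -> `|u - v| = 2 -> `|3 *: u - v| = 4.
Proof.
move=> u1 v1 uv2; apply/eqP; rewrite eq_le; apply/andP; split.
  by have := @ler_norm_3B u v 1 u1; lra.
(* The reverse triangle inequality now gives the lower bound [3 * 2 - 2 = 4]. *)
have -> : 3 *: u - v = 3 *: (u - v) - (- 2) *: v.
  rewrite scalerBr -addrA -opprD -scalerDl -[v in LHS]scale1r.
  by congr (_ - _ *: _); ring.
have := lerB_dist (3 *: (u - v)) ((- 2) *: v).
by rewrite !normrZ normrN !ger0_norm// uv2 v1; lra.
Qed.

Lemma normDZ2 x y : `|x + 2 *: y| = `|3 *: (x + y) - (x - y)| / 2.
Proof.
have -> : 3 *: (x + y) - (x - y) = 2 *: (x + 2 *: y).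
  rewrite [RHS]scalerDr scalerA -natrM !scaler_nat mulrnDl opprB [y - x]addrC.
  by rewrite addrACA -mulrSr (mulrSr x 2) addrK.
by rewrite normrZ ger0_norm// mulrC mulKf.
Qed.

Lemma normZ2D x y : `|2 *: x + y| = `|3 *: (x + y) + (x - y)| / 2.
Proof. by rewrite addrC normDZ2 [y + x]addrC opprB. Qed.

(** With [u = x + y], [v = x - y] and common norm [s], both [|3 *: u - v| / 2] and
    [|3 *: u + v| / 2] are at most [2 * s], and the alternative on [c] lowers one of them to
    [(1 + c) * s]. Taking [c = 1] gives the general bound, [c = 1 - delta] the strict one. *)
Lemma isosceles_quotient_le x y c :
  `|x| = 1 -> isosceles_orthogonal x y -> 0 <= c ->
  `|(x + y) + (x - y)| <= 2 * c * `|x + y| \/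
  `|(x + y) - (x - y)| <= 2 * c * `|x + y| ->
  (`|x + 2 *: y| ^+ 2 + `|2 *: x + y| ^+ 2) / (5 * `|x + y| ^+ 2) <=
  (4 + (1 + c) ^+ 2) / 5.
Proof.
move=> x1 xy c0; set s := `|x + y| => sc.
have sE : `|x - y| = s by [].
have dD : `|(x + y) + (x - y)| <= 2 * s.
  by rewrite (le_trans (ler_normD _ _))// sE -/s; lra.
have dB : `|(x + y) - (x - y)| <= 2 * s.
  by rewrite (le_trans (ler_normB _ _))// sE -/s; lra.
(* The sum of [x + y] and [x - y] is [2 *: x], of norm 2; this makes the denominator positive. *)
have s1 : 1 <= s.
  move: dD; rewrite addrACA subrr addr0 -mulr2n normrMn x1; lra.
have a2 := @ler_norm_3B (x + y) (x - y) s erefl.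
have b2 := @ler_norm_3B (x + y) (- (x - y)) s erefl.
rewrite opprK in b2.
rewrite ler_pdivrMr; last by rewrite mulr_gt0// exprn_gt0//; lra.
have -> : (4 + (1 + c) ^+ 2) / 5 * (5 * s ^+ 2) =
    (2 * s) ^+ 2 + ((1 + c) * s) ^+ 2.
  by field.
have sqr_le a b : 0 <= a -> a <= b -> a ^+ 2 <= b ^+ 2.
  by move=> a0 ab; rewrite lerXn2r ?nnegrE// (le_trans a0).
rewrite normDZ2 normZ2D.
case: sc => sc; [|rewrite [leRHS]addrC];
  apply: lerD; apply: sqr_le; rewrite ?divr_ge0//; lra.
Qed.

Lemma Omega_set_le : ubound (Omega_set X) (8 / 5).
Proof.
move=> _ [x [y [x1 y1 xy ->]]].
have -> : 8 / 5 = (4 + (1 + 1) ^+ 2) / 5 :> R by field.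
apply: isosceles_quotient_le => //; left.
by rewrite (le_trans (ler_normD _ _))// -[X in _ + X]xy; lra.
Qed.

Lemma uniformly_non_square_Omega_lt : uniformly_non_square X -> Omega X < 8 / 5.
Proof.
move=> [d [d0 d1 nsq]]; rewrite /Omega.
have [S0|S0] := pselect (Omega_set X !=set0)%classic; last first.
  (* On an empty index set [sup] takes the default value 0, which is below [8 / 5]. *)
  by rewrite sup_out; [lra|case].
apply: (@le_lt_trans _ _ ((4 + (1 + (1 - d)) ^+ 2) / 5)); last by nra.
apply: ge_sup => // _ [x [y [x1 y1 xy ->]]].
apply: isosceles_quotient_le => //; first lra.
have s0 : 0 < `|x + y|.
  rewrite normr_gt0; apply/eqP => s0; move: xy (x1).
  rewrite /isosceles_orthogonal s0 normr0 => /esym/normr0_eq0/subr0_eq xy.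
  move: s0; rewrite -xy -mulr2n -scaler_nat => /eqP.
  rewrite scaler_eq0 pnatr_eq0/= => /eqP x0.
  by move/eqP; rewrite /unit_sphere/= x0 normr0 eq_sym oner_eq0.
set s := `|x + y| in s0 *.
(* Non-squareness concerns unit vectors; [x + y] and [x - y] share the norm [s], so one scaling
   normalizes both. *)
have unit w : `|w| = s -> @unit_sphere R X (s^-1 *: w).
  move=> ws; rewrite /unit_sphere/= normrZ gtr0_norm ?invr_gt0// ws.
  by rewrite mulVf// gt_eqF.
have := nsq _ _ (unit (x + y) erefl) (unit (x - y) (esym xy)).
rewrite -scalerDr -scalerBr !normrZ gtr0_norm ?invr_gt0//.
by rewrite !ler_pdivrMr// !ler_pdivrMl// => -[] ?; [left|right]; lra.
Qed.

Lemma not_uniformly_non_square_OmegaE :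
  compact (@unit_sphere R X) -> ~ uniformly_non_square X -> Omega X = 8 / 5.
Proof.
move=> cS /(not_uniformly_non_square_attained cS)[u [v [u1 v1 uvD uvB]]].
pose x := 2^-1 *: (u + v); pose y := 2^-1 *: (u - v).
have xyD : x + y = u.
  rewrite /x /y -scalerDr addrACA subrr addr0 -mulr2n -(scaler_nat 2 u).
  by rewrite scalerA mulVf// scale1r.
have xyB : x - y = v.
  rewrite /x /y -scalerBr opprB [u + v]addrC addrACA subrr addr0 -mulr2n.
  by rewrite -(scaler_nat 2 v) scalerA mulVf// scale1r.
have memO : Omega_set X (8 / 5).
  exists x, y; split.
  - by rewrite /unit_sphere/= normrZ uvD gtr0_norm// mulVf.
  - by rewrite /unit_sphere/= normrZ uvB gtr0_norm// mulVf.
  - by rewrite /isosceles_orthogonal xyD xyB u1.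
  - rewrite normDZ2 normZ2D xyD xyB u1 norm_3B//.
    (* Replacing [v] by [- v] gives the other norm [|3 *: u + v| = 4]. *)
    have := @norm_3B u (- v); rewrite normrN opprK => -> //.
    by field.
apply/eqP; rewrite eq_le; apply/andP; split.
  by apply: ge_sup; [exists (8 / 5)|exact: Omega_set_le].
by apply: ub_le_sup => //; exists (8 / 5); exact: Omega_set_le.
Qed.

End Omega.

(* [Vector.axiom n X] is the data of a linear bijection from X onto 'rV[R]_n,
   so that X has finite dimension n. *)
Theorem theorem3p1 (R : realType) (X : completeNormedModType R) (n : nat)
    (dimX : Vector.axiom n X) (n_ge2 : (2 <= n)%N) :
  ~ uniformly_non_square X <-> Omega X = 8 / 5.
Proof.
(* Finite dimension supplies the compact sphere for the forward direction; the converse is the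
   contrapositive of the strict bound. *)
split=> [|OE /uniformly_non_square_Omega_lt]; last by rewrite OE ltxx.
exact: not_uniformly_non_square_OmegaE (unit_sphere_compact _ dimX).
Qed.
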